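(* Let $T$ be a tree with $n \ge 2$ pendent vertices. (i) If $n$ is even, then $M_1(T) \ge 9n-16$, and equality holds if $d_T(m)=4$ for every internal vertex $m \in V(T)\setminus W(T)$. (ii) If $n$ is odd, then $M_1(T) \ge 9n-15$, and equality holds if all internal vertices of $T$ have degree $4$ except exactly one, which has degree $3$.
   Context: Graphs are finite, simple, connected and undirected; a tree is a connected graph with $N$ vertices and $N-1$ edges. $V(T)$ is the vertex set of $T$, and $d_T(v)$ is the degree of a vertex $v$ in $T$. A vertex $v$ is pendent if $d_T(v)=1$; $W(T)$ denotes the set of pendent vertices of $T$. The vertices in $V(T)\setminus W(T)$ are called internal. The first Zagreb index is $M_1(T) := \sum_{v\in V(T)} d_T(v)^2$. *)

(* Defs.v *)
From mathcomp Require Import all_boot.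

Set Implicit Arguments.
Unset Strict Implicit.
Unset Printing Implicit Defensive.

Definition simple_graph (V : finType) (e : rel V) : Prop :=
  symmetric e /\ irreflexive e.

Definition connected_graph (V : finType) (e : rel V) : Prop :=
  forall x y : V, connect e x y.

Definition edges (V : finType) (e : rel V) : {set {set V}} :=
  [set [set p.1; p.2] | p : V * V & e p.1 p.2].

(* "N vertices and N - 1 edges" is written additively, so the graph on the
   empty vertex type is not a tree. *)
Definition is_tree (V : finType) (e : rel V) : Prop :=
  [/\ simple_graph e, connected_graph e & #|V| = #|edges e| + 1].

Definition degree (V : finType) (e : rel V) (v : V) : nat :=
  #|[set w | e v w]|.

Definition pendent (V : finType) (e : rel V) : {set V} :=
  [set v | degree e v == 1].

Definition internal (V : finType) (e : rel V) : {set V} :=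
  ~: pendent e.

(* First Zagreb index. *)
Definition zagreb1 (V : finType) (e : rel V) : nat :=
  \sum_(v : V) degree e v ^ 2.

(* Main.v *)
Require Import Defs.
From mathcomp Require Import all_boot.
From mathcomp Require Import ssrint zify.

(** The bound is the deficit in an exact identity.  A tree on [N] vertices has
    degree sum [2 * N - 2], that is, the integers [d(v) - 2] sum to [-2].
    Writing [d ^ 2 = (d - 4) ^ 2 + 8 * (d - 2)] and summing over all vertices
    gives [M_1 = \sum_v (d(v) - 4) ^ 2 - 16]; every pendent vertex contributes
    [(1 - 4) ^ 2 = 9], so (lemma [zagreb1_tree])
      [M_1 = 9 * n - 16 + \sum_(m internal) (d(m) - 4) ^ 2].
    The last sum is the gap to the bound [9 * n - 16].  It vanishes when all
    internal degrees are [4], and it is [1] when exactly one of them is [3] and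
    the others are [4].

    When [n] is odd the gap cannot be [0]: since [d ^ 2] and [d] have the same
    parity, [M_1] has the parity of the degree sum, which is even (lemma
    [zagreb1_even]), so the gap has the parity of [n]. *)

Set Implicit Arguments.
Unset Strict Implicit.
Unset Printing Implicit Defensive.

Import IntDist.

(** Each edge is the image of exactly two ordered pairs of adjacent vertices,
    while the ordered pairs are also counted, by first component, by the degree
    sum. *)
Lemma handshake (V : finType) (e : rel V) :
  simple_graph e -> \sum_(v : V) degree e v = #|edges e|.*2.
Proof.
move=> [sym_e irr_e].
pose darts := [set p : V * V | e p.1 p.2].
pose ends (p : V * V) := [set p.1; p.2].
have fibre A : A \in edges e -> \sum_(p in darts | ends p == A) 1 = 2.
  case/imsetP=> -[x y]; rewrite inE /= => exy ->.
  have xDy : x != y by apply: contraTneq exy => ->; rewrite irr_e.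
  rewrite sum1dep_card.
  suff -> : [set p in darts | ends p == [set x; y]] = [set (x, y); (y, x)].
    by rewrite cards2 xpair_eqE negb_and xDy.
  apply/setP=> -[a b]; rewrite !inE /ends /= !xpair_eqE.
  apply/andP/orP=> [[eab /eqP abE] | [] /andP[/eqP-> /eqP->]]; last first.
  - by rewrite sym_e exy setUC.
  - by rewrite exy.
  have aDb : a != b by apply: contraTneq eab => ->; rewrite irr_e.
  have : a \in [set x; y] by rewrite -abE set21.
  have : b \in [set x; y] by rewrite -abE set22.
  rewrite !inE => /orP[]/eqP bE /orP[]/eqP aE; move: aDb; rewrite aE bE ?eqxx //.
  - by right.
  - by left.
transitivity (\sum_(p in darts) 1).
  under eq_bigr do rewrite /degree -sum1dep_card.
  by rewrite pair_big_dep /=; apply: eq_bigl => p; rewrite inE.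
rewrite (partition_big ends [in edges e]) /=; last first.
  by move=> p; rewrite inE => ep; apply/imsetP; exists p; rewrite ?inE.
by rewrite (eq_bigr _ fibre) sum_nat_const muln2.
Qed.

Lemma zagreb1_even (V : finType) (e : rel V) :
  simple_graph e -> ~~ odd (zagreb1 e).
Proof.
move=> simple_e.
have -> : odd (zagreb1 e) = odd (\sum_v degree e v).
  rewrite !(big_morph odd oddD (erefl : odd 0 = false)).
  by apply: eq_bigr => v _; rewrite oddX.
by rewrite handshake // odd_double.
Qed.

(** Completing the square around degree [4]: the multiplier [8] of the degree
    sum is the one that makes [d ^ 2 - 8 * d] minimal at [d = 4]. *)
Lemma zagreb1_tree (V : finType) (e : rel V) :
  is_tree e ->
  zagreb1 e + 16 =
    9 * #|pendent e| + \sum_(m in internal e) `|degree e m - 4|%N ^ 2.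
Proof.
move=> [simple_e _ cardV].
have sqE : zagreb1 e + 16 * #|V| =
    8 * \sum_v degree e v + \sum_v `|degree e v - 4|%N ^ 2.
  rewrite /zagreb1 mulnC -sum_nat_const big_distrr -!big_split /=.
  by apply: eq_bigr => v _; have := sqrn_dist (degree e v) 4; lia.
have pendentE : \sum_(v in pendent e) `|degree e v - 4|%N ^ 2
    = 9 * #|pendent e|.
  rewrite mulnC -sum_nat_const; apply: eq_bigr => v.
  by rewrite inE => /eqP->.
move: sqE; rewrite handshake // cardV (bigID [in pendent e]) /= pendentE.
rewrite (eq_bigl [in internal e]); last by move=> v; rewrite !inE.
lia.
Qed.

(* No subtraction below is truncated, since 2 <= n. *)
Theorem theorem1 (V : finType) (e : rel V) (n : nat)
    (tree_e : is_tree e) (pendent_n : #|pendent e| = n) (n_ge2 : 2 <= n) :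
  (~~ odd n ->
     9 * n - 16 <= zagreb1 e /\
     ((forall m : V, m \in internal e -> degree e m = 4) ->
        zagreb1 e = 9 * n - 16)) /\
  (odd n ->
     9 * n - 15 <= zagreb1 e /\
     ((exists m0 : V, [/\ m0 \in internal e, degree e m0 = 3 &
         forall m : V, m \in internal e -> m != m0 -> degree e m = 4]) ->
        zagreb1 e = 9 * n - 15)).
Proof.
have := zagreb1_tree tree_e; rewrite pendent_n.
set gap := \sum_(m in _) _ => M1E.
have M1_even : ~~ odd (zagreb1 e) by apply: zagreb1_even; case: tree_e.
split=> [_ | n_odd]; split.
- lia.
- move=> deg4; suff gap0 : gap = 0 by lia.
  by apply: big1 => m /deg4->.
- have gap_odd : odd gap by lia.
  by have := odd_gt0 gap_odd; lia.
- case=> m0 [m0_int deg3 deg4]; suff gap1 : gap = 1 by lia.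
  rewrite /gap (bigD1 m0) //= deg3 big1 // => m /andP[m_int mDm0].
  by rewrite deg4.
Qed.
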